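(* Let $\mathbf m_\infty=(m_\infty,D,\rho_* )$ be the Brownian map, i.e. any random pointed geodesic compact metric space arising as a subsequential limit as described in the context, and let $\mathrm{KAC}$ be the Brownian cactus built from the same pair $(\mathbf e,Z)$. Then, almost surely, the continuous cactus $\mathrm{Kac}(\mathbf m_\infty)$ is isometric to $\mathrm{KAC}$.
   Context: **Continuous cactus.** For a pointed geodesic compact metric space $\mathbf E=(E,d,\rho)$ and $a,b\in E$ put $$d^{\mathbf E}_{\mathrm{Kac}}(a,b)=d(\rho,a)+d(\rho,b)-2\sup_{\gamma:a\to b}\min_{0\le t\le1}d(\rho,\gamma(t)),$$ the supremum being over continuous curves $\gamma:[0,1]\to E$ with $\gamma(0)=a,\gamma(1)=b$. This is a pseudo-distance; $\mathrm{Kac}(\mathbf E)$ is the quotient of $E$ by $\{d^{\mathbf E}_{\mathrm{Kac}}=0\}$ with the induced distance, pointed at the class of $\rho$. **CRT and labels.** Let $\mathbf e=(\mathbf e_t)_{0\le t\le1}$ be a Brownian excursion with duration $1$. Set $d_{\mathbf e}(s,t)=\mathbf e_s+\mathbf e_t-2\min_{s\wedge t\le r\le s\vee t}\mathbf e_r$ and let $\mathcal T_{\mathbf e}=[0,1]/\{d_{\mathbf e}=0\}$ be the CRT, with metric $d_{\mathbf e}$; $p_{\mathbf e}:[0,1]\to\mathcal T_{\mathbf e}$ is the projection and $[[a,b]]$ the geodesic segment between $a,b\in\mathcal T_{\mathbf e}$. Conditionally on $\mathbf e$, $(Z_t)_{0\le t\le1}$ is a centered Gaussian process with continuous paths and $\mathrm{cov}(Z_s,Z_t)=\min_{s\wedge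 t\le r\le s\vee t}\mathbf e_r$; $Z$ may be viewed as indexed by $\mathcal T_{\mathbf e}$ ($Z_a=Z_t$ if $a=p_{\mathbf e}(t)$). Let $\underline Z=\min Z$ and let $a_*$ be the a.s. unique point of $\mathcal T_{\mathbf e}$ with $Z_{a_*}=\underline Z$. **Brownian cactus.** $d_{\mathrm{KAC}}(a,b)=Z_a+Z_b-2\min_{c\in[[a,b]]}Z_c$ is a pseudo-distance on $\mathcal T_{\mathbf e}$; $\mathrm{KAC}$ is the quotient of $\mathcal T_{\mathbf e}$ by $\{d_{\mathrm{KAC}}=0\}$ with the induced distance, pointed at the class of $a_*$. **Brownian map.** For $a,b\in\mathcal T_{\mathbf e}$ put $a\approx b$ iff there are $s,t\in[0,1]$ with $p_{\mathbf e}(s)=a$, $p_{\mathbf e}(t)=b$ and $Z_r\ge Z_s=Z_t$ for every $r\in[s,t]$, where for $s>t$ the notation $r\in[s,t]$ means $r\in[s,1]\cup[0,t]$. A.s. this is an equivalence relation. Let $m_\infty=\mathcal T_{\mathbf e}/\!\approx$ with the quotient topology, $\Pi:\mathcal T_{\mathbf e}\to m_\infty$ the projection, $\rho_*=\Pi(a_* )$. Let $p\ge2$ be an integer, and for each $n$ let $m_n$ be uniformly distributed over rooted $2p$-angulations (rooted planar maps all of whose faces have degree $2p$) with $n$ faces, with vertex set $V(m_n)$, graph distance $d_{gr}^{m_n}$ and root vertex $\rho_n$. It is known that from any strictly increasing sequence of integers one can extract a subsequence $(n_k)$ such that $$\Big(V(m_{n_k}),\big(\tfrac{9}{4p(p-1)}\big)^{1/4}n_k^{-1/4}d_{gr}^{m_{n_k}},\rho_{n_k}\Big)\to(m_\infty,D,\rho_*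 )$$ in distribution in the (pointed) Gromov-Hausdorff sense, where $D$ is a random metric on $m_\infty$ such that $(m_\infty,D)$ is a.s. a geodesic space and: 1. $D(\rho_*,\Pi(a))=Z_a-\underline Z$ for every $a\in\mathcal T_{\mathbf e}$; 2. for $a=p_{\mathbf e}(s)$, $b=p_{\mathbf e}(t)$, $D(\Pi(a),\Pi(b))\le Z_s+Z_t-2\min_{r\in[s,t]}Z_r$ (same convention for $s>t$); 3. $D(\Pi(a),\Pi(b))\ge Z_a+Z_b-2\min_{c\in[[a,b]]}Z_c$ for every $a,b\in\mathcal T_{\mathbf e}$. ''The Brownian map'' is any such $(m_\infty,D,\rho_* )$ ($D$ may a priori depend on $p$ and on the subsequence). *)

(* Defs.v *)
From HB Require Import structures.
From mathcomp Require Import all_boot all_order all_algebra all_fingroup.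
From mathcomp Require Import all_classical all_reals all_analysis.

Set Implicit Arguments.
Unset Strict Implicit.
Unset Printing Implicit Defensive.

Import Order.TTheory GRing.Theory Num.Theory.
Import numFieldNormedType.Exports.

Local Open Scope classical_set_scope.
Local Open Scope ring_scope.

(* The relations quotiented below are equivalence relations only almost surely,
   so the quotient type is defined for an arbitrary relation, as the type of its
   sets [[set y | r x y]]. *)

Definition quot (T : Type) (r : T -> T -> Prop) : Type :=
  {C : set T | exists x, C = [set y | r x y]}.

Definition cls (T : Type) (r : T -> T -> Prop) (x : T) : quot r :=
  exist _ [set y | r x y] (ex_intro _ x erefl).

Definition quot_repr (T : Type) (r : T -> T -> Prop) (C : quot r) : T :=
  projT1 (cid (proj2_sig C)).

(* [pdist] is a bare function, and being a metric is the predicate [is_metric],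
   rather than [metricType], because the random distance on the Brownian map is a
   metric only almost surely. *)

Record pspace (R : realType) := PSpace {
  psort :> Type;
  pdist : psort -> psort -> R;
  pbase : psort }.

Section PointedSpaces.
Variable R : realType.
Implicit Types X Y : pspace R.

Definition pball X (x : X) (r : R) : set X := [set y | pdist x y < r].

Definition popen X : set_system X :=
  [set U | forall x, U x -> exists2 r : R, 0 < r & pball x r `<=` U].

Lemma popenT X : popen [set: X].
Proof. by move=> x _; exists 1. Qed.

Lemma popenI X : setI_closed (@popen X).
Proof.
move=> U V oU oV x [/oU[r r0 rU] /oV[s s0 sV]].
exists (Num.min r s); first by rewrite lt_min r0.
by move=> y; rewrite /pball/= lt_min => /andP[yr ys]; split; [exact: rU|exact: sV].
Qed.

Lemma popen_bigcup X (I : Type) (f : I -> set X) :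
  (forall i, popen (f i)) -> popen (\bigcup_i f i).
Proof.
move=> fo x [i _ fix_]; have [r r0 rf] := fo i x fix_.
by exists r => // y /rf fy; exists i.
Qed.

(* The topology of [pdist]-open sets; no metric axiom is needed to define it. *)
HB.instance Definition _ X := gen_eqMixin (psort X).
HB.instance Definition _ X := gen_choiceMixin (psort X).
HB.instance Definition _ X := isOpenTopological.Build (psort X)
  (@popenT X) (@popenI X) (@popen_bigcup X).

Definition is_metric X : Prop :=
  [/\ forall x y : X, 0 <= pdist x y,
      forall x y : X, pdist x y = 0 <-> x = y,
      forall x y : X, pdist x y = pdist y x
    & forall x y z : X, pdist x z <= pdist x y + pdist y z].

Definition is_compact_metric X : Prop := is_metric X /\ compact [set: X].

Definition geodesic_path X (a b : X) (g : R -> X) : Prop :=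
  [/\ g 0 = a, g (pdist a b) = b
    & forall s t, s \in `[0, pdist a b] -> t \in `[0, pdist a b] ->
        pdist (g s) (g t) = `|s - t|].

Definition is_geodesic X : Prop :=
  forall a b : X, exists g, geodesic_path a b g.

(* In a tree all geodesics from [a] to [b] have the same image. *)
Definition segment X (a b : X) : set X :=
  [set c | exists2 g, geodesic_path a b g & exists2 t, t \in `[0, pdist a b] & g t = c].

Definition isometric X Y : Prop :=
  exists f : X -> Y, [/\ bijective f,
    forall x y, pdist (f x) (f y) = pdist x y & f (pbase X) = pbase Y].

Definition metric_quotient (T : Type) (d : T -> T -> R) (x0 : T) : pspace R :=
  @PSpace R (quot (fun x y => d x y = 0))
    (fun A B => d (quot_repr A) (quot_repr B)) (cls _ x0).

Definition curve X (a b : X) : set (R -> X) :=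
  [set g : R -> X | [/\ {within `[0, 1], continuous g}, g 0 = a & g 1 = b]].

Definition kac_dist X (a b : X) : R :=
  pdist (pbase X) a + pdist (pbase X) b
  - 2 * sup [set inf [set pdist (pbase X) (g t) | t in `[0, 1]%classic] | g in curve a b].

Definition Kac X : pspace R := metric_quotient (@kac_dist X) (pbase X).

Definition hausdorff_dist (M : metricType R) (A B : set M) : R :=
  inf [set r | [/\ 0 <= r,
    forall a, A a -> exists2 b, B b & mdist a b <= r
  & forall b, B b -> exists2 a, A a & mdist a b <= r]].

Definition gh_dist X Y : R :=
  inf [set r | exists (M : metricType R) (f : X -> M) (g : Y -> M),
    [/\ forall x y, mdist (f x) (f y) = pdist x y,
        forall x y, mdist (g x) (g y) = pdist x y
      & r = Num.max (hausdorff_dist (range f) (range g))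
                    (mdist (f (pbase X)) (g (pbase Y)))]].

(* Bounded continuous functionals on the space of pointed compact metric spaces
   with the distance [gh_dist]; continuity makes [F] invariant under isometries. *)
Definition gh_test_function (F : pspace R -> R) : Prop :=
  (exists M, forall X, is_compact_metric X -> `|F X| <= M) /\
  (forall X, is_compact_metric X -> forall eps, 0 < eps ->
    exists2 delta, 0 < delta & forall Y, is_compact_metric Y ->
      gh_dist X Y < delta -> `|F X - F Y| < eps).

(* [X_k -> M] in distribution for [gh_dist], where the law of [X_k] is given by
   the expectation operator [F |-> EX k F].  Since [M] is a compact metric space
   only almost surely, the random variable [F(M)] is a version [g] of it; its
   existence for all [F] is the measurability of [M] as a random element of the
   Gromov-Hausdorff space. *)
Definition gh_cvg_in_distribution d (Om : measurableType d) (P : probability Om R)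
    (EX : nat -> (pspace R -> R) -> R) (M : Om -> pspace R) : Prop :=
  forall F, gh_test_function F ->
    exists2 g : {RV P >-> R}, {ae P, forall w, g w = F (M w)}
      & (EX k F)%:E @[k --> \oo] --> 'E_P[g]%E.

End PointedSpaces.

(* A rooted map with [N] darts (oriented edges) is a triple [(sigma, alpha, root)]:
   [sigma] sends a dart to the next one around its origin, [alpha] reverses darts.
   Vertices, edges and faces are the cycles of [sigma], [alpha] and
   [sigma \o alpha]; planarity is Euler's formula. *)

Definition rmap (N : nat) : finType := ({perm 'I_N} * {perm 'I_N} * 'I_N)%type.

Section RootedMaps.
Variable N : nat.
Implicit Types m : rmap N.

Definition vperm m : {perm 'I_N} := m.1.1.
Definition eperm m : {perm 'I_N} := m.1.2.
Definition fperm m : {perm 'I_N} := (eperm m * vperm m)%g.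
Definition map_root m : 'I_N := m.2.

Definition is_planar_map m : bool :=
  [&& [forall x, (eperm m x != x) && (eperm m (eperm m x) == x)],
      [forall x, forall y,
         connect (fun a b => (b == vperm m a) || (b == eperm m a)) x y]
    & #|porbits (vperm m)| + #|porbits (fperm m)| == #|porbits (eperm m)| + 2]%N.

Definition rmap_iso : rel (rmap N) := fun m m' =>
  [exists f : {perm 'I_N},
    [&& [forall x, f (vperm m x) == vperm m' (f x)],
        [forall x, f (eperm m x) == eperm m' (f x)]
      & f (map_root m) == map_root m']].

Definition vertex m : finType := {v : {set 'I_N} | v \in porbits (vperm m)}.

Definition vertex_of m (x : 'I_N) : vertex m :=
  exist _ (porbit (vperm m) x) (imset_f _ isT).

Definition map_adjacent m : rel (vertex m) := fun u v =>
  [exists x in val u, eperm m x \in val v].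

Definition graph_dist (R : realType) m (u v : vertex m) : R :=
  inf [set (size s)%:R | s in [set s | path (@map_adjacent m) u s /\ last u s = v]].

End RootedMaps.

Section Angulations.
Variable R : realType.

(* Darts are labelled by ['I_(q * n)]: [n] faces of degree [q] have [q * n] sides. *)
Definition angulations (q n : nat) : {set rmap (q * n)} :=
  [set m | [&& is_planar_map m, #|porbits (fperm m)| == n
             & [forall f in porbits (fperm m), #|f| == q]]].

(* One labelled representative of each isomorphism class: rooted maps are
   considered up to isomorphism. *)
Definition angulation_reps (q n : nat) : {set rmap (q * n)} :=
  transversal (equivalence_partition (@rmap_iso (q * n)) (angulations q n))
    (angulations q n).

Definition rescaled_map (p n : nat) (m : rmap (2 * p * n)) : pspace R :=
  @PSpace R (vertex m)
    (fun u v => (9 / (4 * p%:R * (p%:R - 1))) `^ (1 / 4) * n%:R `^ (- (1 / 4))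
                * graph_dist R u v)
    (vertex_of m (map_root m)).

Definition uniform_angulation_expectation (p n : nat) (F : pspace R -> R) : R :=
  (\sum_(m in angulation_reps (2 * p) n) F (rescaled_map m))
  / #|angulation_reps (2 * p) n|%:R.

End Angulations.

Section CodedTree.
Variable R : realType.

Definition time : Type := set_type `[0 : R, 1]%classic.

Lemma zero_in01 : (0 : R) \in `[0 : R, 1]%classic.
Proof. by rewrite inE/= in_itv/= lexx ler01. Qed.

Definition time0 : time := exist _ 0 zero_in01.

Variables e Z : R -> R.

Definition path_min (f : R -> R) (s t : R) : R :=
  inf [set f r | r in `[Num.min s t, Num.max s t]%classic].

Definition tree_dist (s t : time) : R :=
  e (val s) + e (val t) - 2 * path_min e (val s) (val t).

Definition tree : pspace R := metric_quotient tree_dist time0.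

Definition tree_proj (t : time) : tree := cls _ t.

(* [Z_a], for [a] in the tree.  The representative is irrelevant as soon as [Z]
   is constant on the classes. *)
Definition label (a : tree) : R := Z (val (quot_repr a)).

Definition label_min : R := inf [set Z t | t in `[0, 1]%classic].

(* Almost surely the minimizer is unique, so the choice made by [xget] is immaterial. *)
Definition a_star : tree := xget (pbase tree) [set a | label a = label_min].

Definition KAC_dist (a b : tree) : R :=
  label a + label b - 2 * inf [set label c | c in segment a b].

Definition KAC : pspace R := metric_quotient KAC_dist a_star.

(* [[s, t]], with the convention [[s, 1] U [0, t]] when [s > t]. *)
Definition cyclic_interval (s t : R) : set R :=
  if s <= t then `[s, t]%classic else `[s, 1]%classic `|` `[0, t]%classic.

Definition m_equiv (a b : tree) : Prop :=
  exists s t : time, [/\ tree_proj s = a, tree_proj t = b, Z (val s) = Z (val t)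
    & forall r, cyclic_interval (val s) (val t) r -> Z (val s) <= Z r].

Definition m_infty : Type := quot m_equiv.

Definition m_proj (a : tree) : m_infty := cls m_equiv a.

Definition m_space (D : m_infty -> m_infty -> R) : pspace R :=
  PSpace D (m_proj a_star).

(* The three properties of [D] relative to [(e, Z)].  The first one is stated at
   [a = p_e(t)] for every [t], where [Z_a = Z_t]. *)
Definition m_dist_spec (D : m_infty -> m_infty -> R) : Prop :=
  [/\ forall t : time,
        D (m_proj a_star) (m_proj (tree_proj t)) = Z (val t) - label_min,
      forall s t : time,
        D (m_proj (tree_proj s)) (m_proj (tree_proj t)) <=
        Z (val s) + Z (val t)
        - 2 * inf [set Z r | r in cyclic_interval (val s) (val t)]
    & forall a b : tree, KAC_dist a b <= D (m_proj a) (m_proj b)].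

End CodedTree.

Section RandomObjects.
Context {R : realType} {d : measure_display} {Om : measurableType d}.
Variable P : probability Om R.

(* Only the indices in [[0, 1]] matter. *)
Definition process : Type := R -> {RV P >-> R}.

Definition traj (X : process) (w : Om) : R -> R := fun t => X t w.

Definition continuous_process (X : process) : Prop :=
  {ae P, forall w, {within `[0, 1], continuous (traj X w)}}.

(* Density at [t] of the hitting time of [x] by Brownian motion. *)
Definition hitting_density (t x : R) : R :=
  x / Num.sqrt (2 * pi * t ^+ 3) * expR (- (x ^+ 2 / (2 * t))).

(* Transition density of Brownian motion killed at [0]. *)
Definition killed_density (t x y : R) : R :=
  (expR (- ((x - y) ^+ 2 / (2 * t))) - expR (- ((x + y) ^+ 2 / (2 * t))))
  / Num.sqrt (2 * pi * t).

Fixpoint excursion_weight (B : R -> set R) (t x : R) (s : seq R) : \bar R :=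
  match s with
  | [::] => (hitting_density (1 - t) x)%:E
  | u :: s' => \int[lebesgue_measure]_(y in B u `&` [set y : R | (0 < y)%R])
      ((killed_density (u - t) x y)%:E * excursion_weight B u y s')
  end%E.

(* Brownian excursion with duration [1]: for [0 < t_1 < ... < t_k < 1] the
   density of [(e_(t_1), ..., e_(t_k))] on [x_1, ..., x_k > 0] is
   [2 sqrt(2 pi) q_(t_1)(x_1) p_(t_2 - t_1)(x_1, x_2) ... q_(1 - t_k)(x_k)]
   with [q = hitting_density] and [p = killed_density]. *)
Definition brownian_excursion (e : process) : Prop :=
  [/\ continuous_process e,
      {ae P, forall w, e 0 w = 0 /\ e 1 w = 0}
    & forall (t : R) (s : seq R) (B : R -> set R),
        path <%R 0 (rcons (t :: s) 1) -> (forall u, measurable (B u)) ->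
        (P [set w | forall u, u \in t :: s -> B u (e u w)] =
         \int[lebesgue_measure]_(x in B t `&` [set x : R | (0 < x)%R])
           ((2 * Num.sqrt (2 * pi) * hitting_density t x)%:E
            * excursion_weight B t x s))%E].

Definition sigma_of (e : process) : set_system Om :=
  <<s [set A | exists t B, [/\ t \in `[0, 1], measurable B & A = e t @^-1` B]] >>.

(* The library's [normal_prob 0 0] is not the Dirac mass at [0]. *)
Definition gaussian_law (v : R) (B : set R) : \bar R :=
  if v == 0 then \d_(0 : R) B else normal_prob 0 (Num.sqrt v) B.

(* Conditionally on [e], every linear combination of values of [Z] is centered
   Gaussian with the variance prescribed by [cov(Z_s, Z_t) = min_[s,t] e]. *)
Definition brownian_labels (e Z : process) : Prop :=
  continuous_process Z /\
  forall (k : nat) (t lam : 'I_k -> R) (A : set Om) (B : set R),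
    (forall i, t i \in `[0, 1]) -> sigma_of e A -> measurable B ->
    (P (A `&` [set w | B (\sum_i lam i * Z (t i) w)%R]) =
     \int[P]_(w in A) gaussian_law
       (\sum_i \sum_j lam i * lam j * path_min (traj e w) (t i) (t j))%R B)%E.

(* [(m_infty, D, rho_* )] is the limit in distribution of rescaled uniform
   [2p]-angulations along [n_k = sub k], with the stated properties of [D]. *)
Definition brownian_map (p : nat) (sub : nat -> nat) (e Z : process)
    (D : forall w, m_infty (traj e w) (traj Z w) ->
                   m_infty (traj e w) (traj Z w) -> R) : Prop :=
  [/\ forall s t : time R, measurable_fun [set: Om] (fun w =>
        D w (m_proj _ (tree_proj _ s)) (m_proj _ (tree_proj _ t))),
      gh_cvg_in_distribution P
        (fun k => uniform_angulation_expectation p (sub k))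
        (fun w => m_space (D w)),
      {ae P, forall w, is_compact_metric (m_space (D w))
                       /\ is_geodesic (m_space (D w))}
    & {ae P, forall w, m_dist_spec (D w)}].

End RandomObjects.

(* Main.v *)
Require Import Defs.
From mathcomp Require Import all_boot all_order all_algebra.
From mathcomp Require Import all_classical all_reals all_analysis.
From mathcomp Require Import lra.

Import Order.TTheory GRing.Theory Num.Theory.
Import numFieldNormedType.Exports.

Local Open Scope classical_set_scope.
Local Open Scope ring_scope.

(* Everything is deterministic once [e] and [Z] are continuous, [D] is a metric and
   the three properties of [D] hold: [d_Kac (Pi a) (Pi b) = d_KAC a b] for all [a], [b].
   Since [D rho (Pi c)] is the label of [c] minus the least label, this says that the
   best minimum of the label along curves from [Pi a] to [Pi b] is its minimum over
   the segment [[a, b]].  The image of [[a, b]] is such a curve, because property 2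
   makes [Pi] continuous.  Conversely, by property 3 the label exceeds its minimum over
   [[c, c']] by little when [D (Pi c) (Pi c')] is small, and [[a, b]] is contained in
   the union of the segments joining successive points of a fine subdivision. *)

(** * Minima of a continuous function over subintervals of $[0,1]$ *)

Section PathMin.
Context {R : realType}.
Variable f : R -> R.
Hypothesis cf : {within `[0, 1], continuous f}.
Implicit Types r s t u x y : R.

Lemma within01_continuousP (g : R -> R) :
  {within `[0, 1], continuous g} <->
  forall x, 0 <= x <= 1 -> forall eps, 0 < eps ->
    exists2 delta, 0 < delta & forall y, 0 <= y <= 1 ->
      `|x - y| < delta -> `|g x - g y| < eps.
Proof.
rewrite subspace_continuousP; split=> [cg x x01 eps eps0|cg x /=].
  have /cvgrPdist_lt/(_ _ eps0) : g y @[y --> within `[0, 1] (nbhs x)] --> g x.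
    by apply: cg; rewrite /= in_itv.
  move=> /nbhs_ballP[delta /= delta0 dg]; exists delta => // y y01 xy.
  by apply: (dg y) => //=; rewrite in_itv.
rewrite in_itv/= => x01; apply/cvgrPdist_lt => eps eps0.
have [delta delta0 dg] := cg x x01 eps eps0.
apply/nbhs_ballP; exists delta => //= y xy /=; rewrite in_itv/= => y01.
exact: dg.
Qed.

Lemma between01 r s t : 0 <= s <= 1 -> 0 <= t <= 1 ->
  Num.min s t <= r <= Num.max s t -> 0 <= r <= 1.
Proof. by case: (leP s t) => _ *; lra. Qed.

Lemma path_min_attained s t : 0 <= s <= 1 -> 0 <= t <= 1 ->
  exists2 r, Num.min s t <= r <= Num.max s t &
    path_min f s t = f r /\
    forall x, Num.min s t <= x <= Num.max s t -> f r <= f x.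
Proof.
move=> s01 t01.
have mM : Num.min s t <= Num.max s t by rewrite ge_min le_max lexx.
have [|r] := EVT_min mM (f := f).
  apply: continuous_subspaceW cf => x /=; rewrite !in_itv/=.
  exact: between01.
rewrite in_itv/= => rst rmin; exists r => //.
have {}rmin x : Num.min s t <= x <= Num.max s t -> f r <= f x.
  by move=> xst; apply: rmin; rewrite in_itv.
split=> //; apply/eqP; rewrite eq_le; apply/andP; split.
  apply: ge_inf; last by exists r => //=; rewrite in_itv.
  by exists (f r) => _ [x /=] + <-; rewrite in_itv/=; exact: rmin.
apply: lb_le_inf; first by exists (f r), r => //=; rewrite in_itv.
by move=> _ [x /=] + <-; rewrite in_itv/=; exact: rmin.
Qed.

Lemma path_min_le s t r : 0 <= s <= 1 -> 0 <= t <= 1 ->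
  Num.min s t <= r <= Num.max s t -> path_min f s t <= f r.
Proof. by move=> s01 t01 rst; have [x _ [-> ]] := path_min_attained s t s01 t01; exact. Qed.

Lemma path_min_lel s t : 0 <= s <= 1 -> 0 <= t <= 1 -> path_min f s t <= f s.
Proof. by move=> s01 t01; apply: path_min_le => //; rewrite ge_min le_max lexx. Qed.

Lemma path_min_ler s t : 0 <= s <= 1 -> 0 <= t <= 1 -> path_min f s t <= f t.
Proof. by move=> s01 t01; apply: path_min_le => //; rewrite ge_min le_max lexx !orbT. Qed.

Lemma path_minC s t : path_min f s t = path_min f t s.
Proof. by rewrite /path_min minC maxC. Qed.

Lemma path_minxx s : 0 <= s <= 1 -> path_min f s s = f s.
Proof.
move=> s01; have [r] := path_min_attained s s s01 s01.
by rewrite minxx maxxx => /le_anti <- [].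
Qed.

(** A point where the minimum over $[s,t]$ is attained lies between $s$ and $u$ or between $u$ and
    $t$. *)
Lemma path_min_ultra s t u : 0 <= s <= 1 -> 0 <= t <= 1 -> 0 <= u <= 1 ->
  path_min f s u <= path_min f s t \/ path_min f u t <= path_min f s t.
Proof.
move=> s01 t01 u01; have [r rst [-> _]] := path_min_attained s t s01 t01.
have [rsu|rsu] := boolP (Num.min s u <= r <= Num.max s u).
  by left; exact: path_min_le.
right; apply: path_min_le => //.
move: rsu rst; case: (leP s u); case: (leP u t); case: (leP s t) => *; lra.
Qed.

Lemma path_min_near s eps : 0 <= s <= 1 -> 0 < eps ->
  exists2 delta, 0 < delta & forall t, 0 <= t <= 1 -> `|s - t| < delta ->
    f s + f t - 2 * path_min f s t < eps.
Proof.
(* One third of [eps] because $f(s)+f(t)-2f(r)=2(f(s)-f(r))+(f(t)-f(s))$, where the minimizer $r$ is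
   as close to $s$ as $t$ is. *)
move=> s01 eps0; have e3 : 0 < eps / 3 by lra.
have [delta delta0 df] := (within01_continuousP f).1 cf s s01 _ e3.
exists delta => // t t01 st.
have [r rst [-> _]] := path_min_attained s t s01 t01.
have rs : `|s - r| < delta.
  move: rst st; case: (leP s t) => h hr; rewrite !ltr_norml; lra.
have := df r (between01 _ _ _ s01 t01 rst) rs.
by have := df t t01 st; rewrite !ltr_norml; lra.
Qed.

(** By the ultrametric inequality the minima from $s$ to $x$ and from $s$ to $y$ differ by at most
    $f(x)+f(y)-2\min_{[x,y]}f$, which is small for $y$ near $x$. *)
Lemma continuous_path_min s : 0 <= s <= 1 ->
  {within `[0, 1], continuous (path_min f s)}.
Proof.
move=> s01; apply/within01_continuousP => x x01 eps eps0.
have [delta delta0 df] := path_min_near x eps x01 eps0.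
exists delta => // y y01 /(df y y01).
have := path_min_ultra s x y s01 x01 y01.
have := path_min_ultra s y x s01 y01 x01.
have := path_min_ler s x s01 x01; have := path_min_ler s y s01 y01.
have := path_min_lel x y x01 y01; have := path_min_ler x y x01 y01.
by rewrite (path_minC y x) ltr_norml => ????[?|?][?|?] ?; lra.
Qed.

(** In the tree coded by [f], [r] represents the ancestor of [s] at height [h]. The intermediate
    value theorem for [path_min f s] gives an interval from [s] with minimum [h], and [r] is a point
    where this minimum is attained. *)
Lemma ancestor_exists s t h : 0 <= s <= 1 -> 0 <= t <= 1 ->
  path_min f s t <= h <= f s ->
  exists2 r, 0 <= r <= 1 & f r = h /\ path_min f s r = h.
Proof.
move=> s01 t01 hst.
have mM : Num.min s t <= Num.max s t by rewrite ge_min le_max lexx.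
have [||x] := @IVT _ (path_min f s) _ _ h mM.
- apply: continuous_subspaceW (continuous_path_min s s01) => x /=.
  by rewrite !in_itv/=; exact: between01.
- have := path_minxx s s01; have := path_min_lel s t s01 t01.
  by case: (leP s t) => _ ??; rewrite ge_min le_max; lra.
rewrite in_itv/= => /(between01 _ _ _ s01 t01) x01 hx.
have [r rsx [fr rmin]] := path_min_attained s x s01 x01.
have r01 := between01 _ _ _ s01 x01 rsx.
exists r => //; split; first by rewrite -fr.
apply/eqP; rewrite eq_le -{1}hx fr path_min_ler//=.
have [y ysr [-> _]] := path_min_attained s r s01 r01.
rewrite -hx; apply: path_min_le => //.
by move: rsx ysr; case: (leP s x); case: (leP s r) => *; lra.
Qed.

End PathMin.

(** * Metric quotients of pseudometric spaces *)

Section MetricQuotient.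
Context {R : realType}.

Definition is_pseudometric {T : Type} (d : T -> T -> R) : Prop :=
  [/\ forall x, d x x = 0, forall x y, d x y = d y x
    & forall x y z, d x z <= d x y + d y z].

Lemma pseudometric_ge0 {T : Type} (d : T -> T -> R) : is_pseudometric d ->
  forall x y, 0 <= d x y.
Proof. by case=> d0 dC dtri x y; have := dtri x y x; rewrite d0 (dC y x); lra. Qed.

Lemma cls_quot_repr {T : Type} (r : T -> T -> Prop) (C : quot r) :
  cls r (quot_repr C) = C.
Proof.
rewrite /quot_repr; case: C => C CP /=; case: cid => x /= Cx.
by rewrite Cx in CP *; congr exist; exact: Prop_irrelevance.
Qed.

(** Reflexivity puts [x] in its own class, which is also the set of points related to the chosen
    representative. *)
Lemma quot_repr_cls {T : Type} (r : T -> T -> Prop) (x : T) :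
  r x x -> r (quot_repr (cls r x)) x.
Proof.
move=> rxx; have /(congr1 (@proj1_sig _ _)) := cls_quot_repr r (cls r x).
by move=> /= /seteqP[_] /(_ x); exact.
Qed.

Context {T : Type}.
Variables (d : T -> T -> R) (x0 : T).
Hypothesis pd : is_pseudometric d.
Let Q := metric_quotient d x0.
Let cl (x : T) : Q := cls _ x.

Lemma pdist_cls x y : pdist (cl x) (cl y) = d x y.
Proof.
case: (pd) => d0 dC dtri.
have rx := quot_repr_cls (fun x y => d x y = 0) x (d0 x).
have ry := quot_repr_cls (fun x y => d x y = 0) y (d0 y).
rewrite /=; move: rx ry; set x' := quot_repr _; set y' := quot_repr _ => rx ry.
have := dtri x' x y'; have := dtri x y y'; have := dtri x x' y.
have := dtri x' y' y; rewrite (dC x x') (dC y y'); lra.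
Qed.

Lemma cls_eqP x y : cl x = cl y <-> d x y = 0.
Proof.
case: (pd) => d0 dC dtri; split=> [xy|xy]; first by rewrite -pdist_cls xy pdist_cls.
apply: eq_exist; apply/seteqP; split=> z /= xz.
  have := dtri y x z; have := pseudometric_ge0 d pd y z; rewrite (dC y x) xy; lra.
have := dtri x y z; have := pseudometric_ge0 d pd x z; rewrite xy; lra.
Qed.

Lemma is_metric_quotient : is_metric Q.
Proof.
have surj (A : Q) : exists x, cl x = A by exists (quot_repr A); exact: cls_quot_repr.
case: (pd) => d0 dC dtri; split=> [A B|A B|A B|A B C].
- exact: (pseudometric_ge0 d pd).
- have [[x <-] [y <-]] := (surj A, surj B).
  by rewrite pdist_cls; split=> /cls_eqP.
- exact: dC.
- exact: dtri.
Qed.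

End MetricQuotient.

(** The isometry is induced by a section [k] of [h]. Through [k], [d1] inherits the pseudometric
    axioms; with [h] the projection to the Brownian map, they pass from [KAC_dist] to [kac_dist]. *)
Lemma isometric_metric_quotient {R : realType} {T1 T2 : Type}
    (d1 : T1 -> T1 -> R) (d2 : T2 -> T2 -> R) (h : T2 -> T1) (x0 : T2) :
  is_pseudometric d2 -> (forall x, exists y, h y = x) ->
  (forall y y', d1 (h y) (h y') = d2 y y') ->
  isometric (metric_quotient d1 (h x0)) (metric_quotient d2 x0).
Proof.
move=> pd2 /choice[k kK] hd.
have d12 x x' : d1 x x' = d2 (k x) (k x') by rewrite -hd !kK.
have pd1 : is_pseudometric d1.
  case: pd2 => d0 dC dtri; split=> [x|x y|x y z].
  - by rewrite d12.
  - by rewrite d12 dC -d12.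
  - by rewrite !d12.
set Q1 := metric_quotient d1 _; set Q2 := metric_quotient d2 _.
pose c1 x : Q1 := cls _ x; pose c2 y : Q2 := cls _ y.
pose f (A : Q1) : Q2 := c2 (k (quot_repr A)).
pose g (B : Q2) : Q1 := c1 (h (quot_repr B)).
have c2E y y' : c2 y = c2 y' <-> d2 y y' = 0 by exact: cls_eqP.
have c1E y y' : c1 y = c1 y' <-> d1 y y' = 0 by exact: cls_eqP.
have d1r x : d1 (quot_repr (c1 x)) x = 0.
  apply: (quot_repr_cls (fun x y => d1 x y = 0)); by case: pd1.
have d2r x : d2 (quot_repr (c2 x)) x = 0.
  apply: (quot_repr_cls (fun x y => d2 x y = 0)); by case: pd2.
exists f; split.
- exists g => [A|B].
    rewrite /g /f -[RHS]cls_quot_repr; apply/c1E.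
    by rewrite -[X in d1 _ X]kK hd; exact: d2r.
  rewrite /g /f -[RHS]cls_quot_repr; apply/c2E.
  by rewrite -hd kK; exact: d1r.
- by move=> A B; rewrite /f [LHS]pdist_cls//= d12.
- by apply/c2E; rewrite -hd kK; exact: d1r.
Qed.

(** * Geodesics and segments under the four-point condition *)

Section FourPoint.
Context {R : realType}.
Variable X : pspace R.
Hypothesis mX : is_metric X.
Hypothesis four_point : forall a b c x : X,
  pdist a b + pdist c x <= pdist a c + pdist b x \/
  pdist a b + pdist c x <= pdist a x + pdist b c.
Hypothesis division : forall (a b : X) u, 0 <= u <= pdist a b ->
  exists2 c, pdist a c = u & pdist c b = pdist a b - u.

(* By the four-point condition, points [g u] with [d(a, g u) = u] and
   [d(g u, b) = d(a, b) - u], however chosen, form a geodesic. *)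
Lemma geodesic_through (a b c : X) : pdist a c + pdist c b = pdist a b ->
  exists2 g, geodesic_path a b g & g (pdist a c) = c.
Proof.
case: mX => d0 deq dC dtri acb.
have /choice[g gP] u : exists x, (0 <= u <= pdist a b ->
    pdist a x = u /\ pdist x b = pdist a b - u) /\ (u = pdist a c -> x = c).
  (* The value at parameter [pdist a c] is forced to be [c], so that the geodesic passes through
     [c]. *)
  have [->|uc] := eqVneq u (pdist a c); first by exists c; split => //; lra.
  have [/division[x xu xb]|uab] := boolP (0 <= u <= pdist a b).
    by exists x; split=> // ue; rewrite ue eqxx in uc.
  by exists c; split.
exists g; last by apply: (gP _).2.
have gd u : 0 <= u <= pdist a b -> pdist a (g u) = u /\ pdist (g u) b = pdist a b - u.
  exact: (gP _).1.
have ab0 := d0 a b.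
split.
- by apply/esym/deq; apply: (gd 0 _).1; rewrite lexx.
- by apply/deq; have [] := gd (pdist a b); rewrite ?lexx ?ab0//; lra.
move=> s t; rewrite !in_itv/= => /gd[as_ sb] /gd[at_ tb].
apply/eqP; rewrite eq_le; apply/andP; split.
  (* Since $d(a,g_s)+d(b,g_t)=d(a,b)+s-t$, the two cases bound $d(g_s,g_t)$ by $s-t$ or by $t-s$. *)
  have := four_point a b (g s) (g t); rewrite (dC b (g t)) (dC b (g s)) ler_normr.
  by move=> [|] ?; apply/orP; [left|right]; lra.
have := dtri a (g s) (g t); have := dtri a (g t) (g s).
by rewrite (dC (g t)) ler_norml => *; apply/andP; split; lra.
Qed.

Lemma four_point_geodesic : is_geodesic X.
Proof.
case: mX => d0 deq dC dtri a b.
have [|g gP _] := geodesic_through a b a; last by exists g.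
by rewrite ((deq a a).2 erefl) add0r.
Qed.

(** Replaces geodesics by an equation between distances, so that facts on segments become linear
    arithmetic. *)
Lemma segmentP (a b c : X) :
  segment a b c <-> pdist a c + pdist c b = pdist a b.
Proof.
case: mX => d0 deq dC dtri; split.
  move=> [g [g0 g1 gd] [t t01 <-]].
  have t0 : 0 \in `[0, pdist a b] by rewrite in_itv/= lexx d0.
  have t1 : pdist a b \in `[0, pdist a b] by rewrite in_itv/= lexx d0.
  rewrite -{1}g0 -{1}g1 (gd _ _ t0 t01) (gd _ _ t01 t1).
  move: t01; rewrite in_itv/= => t01.
  rewrite [X in X + _]distrC [X in _ + X]distrC !ger0_norm; lra.
move=> acb; have [g gP gc] := geodesic_through a b c acb.
exists g => //; exists (pdist a c) => //.
by rewrite in_itv/= d0/=; have := d0 c b; lra.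
Qed.

Lemma segmentC (a b c : X) : segment a b c <-> segment b a c.
Proof.
by case: mX => d0 deq dC dtri; rewrite !segmentP (dC a b) (dC a c) (dC c b) addrC.
Qed.

Lemma segment_left (a b : X) : segment a b a.
Proof. by case: mX => d0 deq dC dtri; rewrite segmentP ((deq a a).2 erefl) add0r. Qed.

Lemma segment_diag (a c : X) : segment a a c -> c = a.
Proof.
case: mX => d0 deq dC dtri; rewrite segmentP ((deq a a).2 erefl) => ac.
by apply/deq; have := d0 a c; have := d0 c a; lra.
Qed.

(** Substituting $d(a,b)=d(a,x)+d(x,b)$ in the four-point condition leaves $d(a,x)+d(x,c)\le d(a,c)$
    or $d(c,x)+d(x,b)\le d(c,b)$; the triangle inequality gives equality. *)
Lemma segment_triangle (a b c x : X) :
  segment a b x -> segment a c x \/ segment c b x.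
Proof.
case: mX => d0 deq dC dtri; rewrite !segmentP => axb.
have := dtri a x c; have := dtri c x b; have := four_point a b c x.
by rewrite (dC x c) (dC b x) (dC b c) => -[?|?] ??; [left|right]; lra.
Qed.

End FourPoint.

(** * Continuity of curves in metric spaces, and induction along $[0,1]$ *)

Lemma pspace_nbhsP {R : realType} (X : pspace R) (x : X) (U : set X) :
  is_metric X -> nbhs x U <-> exists2 r : R, 0 < r & pball x r `<=` U.
Proof.
move=> [d0 deq dC dtri]; rewrite nbhsE; split=> [[V [oV Vx] VU]|[r r0 rU]].
  have [r r0 rV] := oV x Vx.
  by exists r => // y /rV/VU.
exists (pball x r) => //; split; last by rewrite /pball/= ((deq x x).2 erefl).
move=> y xy; exists (r - pdist x y); first by move: xy; rewrite /pball/=; lra.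
move=> z; rewrite /pball/= => yz; have := dtri x y z.
by move: yz; move: (pdist x y) (pdist y z) (pdist x z) => ? ? ?; lra.
Qed.

Lemma pspace_within01_continuousP {R : realType} (X : pspace R) (g : R -> X) :
  is_metric X -> {within `[0, 1], continuous g} <->
  forall x, 0 <= x <= 1 -> forall eps, 0 < eps ->
    exists2 delta, 0 < delta & forall y, 0 <= y <= 1 ->
      `|x - y| < delta -> pdist (g x) (g y) < eps.
Proof.
move=> mX; rewrite subspace_continuousP; split=> [cg x x01 eps eps0|cg x /=].
  have /(_ (pball (g x) eps)) : g y @[y --> within `[0, 1] (nbhs x)] --> g x.
    by apply: cg; rewrite /= in_itv.
  case; first by apply/(pspace_nbhsP _ _ _ mX); exists eps.
  move=> delta /= delta0 dg; exists delta => // y y01 xy.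
  by apply: (dg y) => //=; rewrite in_itv.
rewrite in_itv/= => x01 U /(pspace_nbhsP _ _ _ mX)[eps eps0 epsU].
have [delta delta0 dg] := cg x x01 eps eps0.
apply/nbhs_ballP; exists delta => //= y xy /=; rewrite in_itv/= => y01.
by apply: epsU; exact: dg.
Qed.

(** Near the supremum of the points satisfying [P], the step carries [P] to $\min(1,\sup
    S+\delta/2)$. This point belongs to $S$, so it cannot exceed $\sup S$ and must be $1$. *)
Lemma unit_interval_induction {R : realType} (P : R -> Prop) :
  P 0 ->
  (forall x, 0 <= x <= 1 -> exists2 delta, 0 < delta &
    forall u v, 0 <= u <= 1 -> 0 <= v <= 1 ->
      `|x - u| < delta -> `|x - v| < delta -> P u -> P v) ->
  P 1.
Proof.
move=> P0 step; pose S := [set x : R | 0 <= x <= 1 /\ P x].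
have S0 : S 0 by split=> //; rewrite lexx ler01.
have Sub : has_ubound S by exists 1 => x [/andP[]].
have x01 : 0 <= sup S <= 1.
  apply/andP; split; first exact: ub_le_sup.
  by apply: ge_sup; [exists 0|move=> x [/andP[]]].
have [delta delta0 dP] := step _ x01.
have [|u [u01 Pu] xu] := @sup_adherent _ S delta delta0; first by split; [exists 0|].
have ux : u <= sup S by exact: ub_le_sup.
have : P (Num.min 1 (sup S + delta / 2)).
  apply: (dP u) => //; rewrite ?ltr_norml; last 2 first.
  - by lra.
  - by case: (leP 1) => ?; lra.
  - by case: (leP 1) => ?; lra.
case: (leP 1) => // v1 Pv.
have : sup S + delta / 2 <= sup S by apply: ub_le_sup => //; split=> //; lra.
by lra.
Qed.

(** Each variable stands for the minimum of $\mathbf e$ between the two times that name it. The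
    heights cancel in the four-point condition for [tree_dist], and the factor $-2$ reverses the
    inequality into this one. *)
Lemma ultrametric_four_point {R : realType} (rs rt ru st su tu : R) :
  rt <= rs \/ st <= rs -> ru <= rs \/ su <= rs ->
  rt <= tu \/ ru <= tu -> st <= tu \/ su <= tu ->
  rt + su <= rs + tu \/ ru + st <= rs + tu.
Proof.
move=> rs_t rs_u tu_r tu_s.
case: (lerP rt su) => rt_su; case: (lerP ru st) => ru_st.
- case: (lerP su st) => su_st;
    [left; case: tu_s; case: rs_t|right; case: tu_s; case: rs_u]; lra.
- case: (lerP su ru) => su_ru;
    [left; case: tu_r; case: rs_u|right; case: tu_s; case: rs_u]; lra.
- case: (lerP rt st) => rt_st;
    [left; case: tu_s; case: rs_t|right; case: tu_r; case: rs_t]; lra.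
- case: (lerP rt ru) => rt_ru;
    [left; case: tu_r; case: rs_u|right; case: tu_r; case: rs_t]; lra.
Qed.

(** * The real tree coded by $\mathbf e$ *)

Section CodedTreeTheory.
Context {R : realType}.
Variable e : R -> R.
Hypothesis ce : {within `[0, 1], continuous e}.
Implicit Types (s t u : time R) (a b c : tree e).

Lemma time01 s : 0 <= val s <= 1.
Proof. by have := valP s; rewrite inE/= in_itv. Qed.

Lemma time_of {x : R} : 0 <= x <= 1 -> exists t : time R, val t = x.
Proof.
move=> x01; have xI : x \in `[0, 1]%classic by rewrite inE/= in_itv.
by exists (exist _ x xI).
Qed.

Lemma is_pseudometric_tree_dist : is_pseudometric (tree_dist e).
Proof.
rewrite /tree_dist; split=> [s|s t|s t u].
- by rewrite path_minxx ?time01//; lra.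
- by rewrite path_minC; lra.
- have := path_min_ultra e ce _ _ _ (time01 s) (time01 u) (time01 t).
  have := path_min_ler e ce _ _ (time01 s) (time01 t).
  by have := path_min_lel e ce _ _ (time01 t) (time01 u) => ?? [?|?]; lra.
Qed.

Lemma pdist_tree s t : pdist (tree_proj e s) (tree_proj e t) = tree_dist e s t.
Proof. exact: (pdist_cls (tree_dist e) (time0 R) is_pseudometric_tree_dist). Qed.

Lemma tree_projP a : exists t, tree_proj e t = a.
Proof. by exists (quot_repr a); exact: cls_quot_repr. Qed.

Lemma is_metric_tree : is_metric (tree e).
Proof. exact: (is_metric_quotient (tree_dist e) (time0 R) is_pseudometric_tree_dist). Qed.

Lemma tree_four_point a b c d :
  pdist a b + pdist c d <= pdist a c + pdist b d \/
  pdist a b + pdist c d <= pdist a d + pdist b c.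
Proof.
have [r <-] := tree_projP a; have [s <-] := tree_projP b.
have [t <-] := tree_projP c; have [u <-] := tree_projP d.
rewrite !pdist_tree /tree_dist.
have ultra (x y z : time R) :=
  path_min_ultra e ce _ _ _ (time01 x) (time01 y) (time01 z).
have C (x y : time R) := path_minC e (val x) (val y).
have := ultra r s t; have := ultra r s u; have := ultra t u r; have := ultra t u s.
rewrite (C t s) (C u s) (C t r) => tu_s tu_r rs_u rs_t.
have [h|h] := ultrametric_four_point _ _ _ _ _ _ rs_t rs_u tu_r tu_s.
  by left; lra.
by right; lra.
Qed.

(** The point is an ancestor of [s] as long as [h] does not exceed the descent from [s] to the
    common ancestor; beyond that it is an ancestor of [t], at distance $d(a,b)-h$ from [t]. *)
Lemma tree_division a b (h : R) : 0 <= h <= pdist a b ->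
  exists2 c, pdist a c = h & pdist c b = pdist a b - h.
Proof.
have [[s <-] [t <-]] := (tree_projP a, tree_projP b).
have ancestor_division (s' t' : time R) (h' : R) : 0 <= h' <= tree_dist e s' t' ->
    h' <= e (val s') - path_min e (val s') (val t') ->
    exists2 r, tree_dist e s' r = h' & tree_dist e r t' = tree_dist e s' t' - h'.
  move=> h0 hs.
  have [|r] := ancestor_exists e ce _ _ (e (val s') - h') (time01 s') (time01 t').
    by lra.
  move=> /time_of[x <-] [ex sx].
  have sxh : tree_dist e s' x = h' by rewrite /tree_dist ex sx; lra.
  exists x => //; apply/eqP; rewrite eq_le; apply/andP; split; last first.
    by have [_ _ /(_ s' x t')] := is_pseudometric_tree_dist; lra.
  have := path_min_ultra e ce _ _ _ (time01 x) (time01 t') (time01 s').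
  by rewrite (path_minC e (val x) (val s')) sx /tree_dist ex => -[?|?]; lra.
rewrite pdist_tree => h0.
have [hs|hs] := lerP h (e (val s) - path_min e (val s) (val t)).
  have [r sr rt] := ancestor_division s t h h0 hs.
  by exists (tree_proj e r); rewrite pdist_tree.
have [_ dC _] := is_pseudometric_tree_dist.
have [||r tr rs] := ancestor_division t s (tree_dist e s t - h).
- by rewrite (dC t s); lra.
- by rewrite path_minC /tree_dist; lra.
exists (tree_proj e r); rewrite pdist_tree; last by rewrite dC.
by rewrite dC rs (dC t s); lra.
Qed.

End CodedTreeTheory.

(** * Labels on the tree and the Brownian cactus pseudo-distance *)

Section Cactus.
Context {R : realType}.
Variables e Z : R -> R.
Variable D : m_infty e Z -> m_infty e Z -> R.
Hypothesis ce : {within `[0, 1], continuous e}.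
Hypothesis cZ : {within `[0, 1], continuous Z}.
Hypothesis mD : is_metric (m_space D).
Hypothesis DP : m_dist_spec D.
Implicit Types a b c : tree e.

Local Notation Pi := (@m_proj R e Z).
Local Notation pe := (tree_proj e).

Lemma m_projP (x : m_infty e Z) : exists a, Pi a = x.
Proof. by exists (quot_repr x); exact: cls_quot_repr. Qed.

(** Property 1 of [D] recovers $Z_t$ from the tree point of $t$, so $Z$ takes the same value at $t$
    and at the representative read by [label]. *)
Lemma label_proj (t : time R) : label Z (pe t) = Z (val t).
Proof.
have [D1 _ _] := DP.
have reprK : pe (quot_repr (pe t)) = pe t by exact: cls_quot_repr.
by have := D1 (quot_repr (pe t)); rewrite reprK D1 /label; lra.
Qed.

Lemma D_base a : D (Pi (a_star e Z)) (Pi a) = label Z a - label_min Z.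
Proof. by have [t <-] := tree_projP e a; rewrite label_proj; case: DP. Qed.

(** The excess over [label_min] is a distance to the base point. This lower bound makes the infima
    of labels over segments genuine. *)
Lemma label_ge a : label_min Z <= label Z a.
Proof. by have [d0 _ _ _] := mD; have := d0 (Pi (a_star e Z)) (Pi a); rewrite /= D_base; lra. Qed.

Definition segment_min a b : R := inf [set label Z c | c in segment a b].

Local Notation M := segment_min.

Let mT := is_metric_tree e ce.
Let T4 := tree_four_point e ce.
Let Tdiv := tree_division e ce.

Lemma segment_min_le a b c : segment a b c -> M a b <= label Z c.
Proof.
move=> abc; apply: ge_inf; last by exists c.
by exists (label_min Z) => _ [x _ <-]; exact: label_ge.
Qed.

Lemma segment_min_ge a b (h : R) : (forall c, segment a b c -> h <= label Z c) -> h <= M a b.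
Proof.
move=> hle; apply: lb_le_inf; last by move=> _ [c /hle + <-].
by exists (label Z a), a => //; apply: segment_left _ mT T4 Tdiv _ _.
Qed.

Lemma segment_minC a b : M a b = M b a.
Proof.
by apply/eqP; rewrite eq_le; apply/andP; split; apply: segment_min_ge => c abc;
  apply: segment_min_le; exact/(segmentC _ mT T4 Tdiv).
Qed.

Lemma segment_minxx a : M a a = label Z a.
Proof.
apply/eqP; rewrite eq_le segment_min_le/=; last exact: segment_left _ mT T4 Tdiv _ _.
by apply: segment_min_ge => c /(segment_diag _ mT T4 Tdiv)->.
Qed.

Lemma segment_min_lel a b : M a b <= label Z a.
Proof. by apply: segment_min_le; exact: segment_left _ mT T4 Tdiv _ _. Qed.

Lemma segment_min_ler a b : M a b <= label Z b.
Proof. by rewrite segment_minC segment_min_lel. Qed.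

(** The segment from [a] to [b] lies in the union of those from [a] to [c] and from [c] to [b]. The
    bound is proved for the smaller of the two minima, because which case holds depends on the point
    of the segment. *)
Lemma segment_min_ultra a b c : M a c <= M a b \/ M c b <= M a b.
Proof.
have : Num.min (M a c) (M c b) <= M a b; last by rewrite ge_min => /orP.
apply: segment_min_ge => x /(segment_triangle _ mT T4 Tdiv _ _ c)[cx|cx].
  by rewrite ge_min; apply/orP; left; exact: segment_min_le cx.
by rewrite ge_min; apply/orP; right; exact: segment_min_le cx.
Qed.

Lemma KAC_distE a b : KAC_dist Z a b = label Z a + label Z b - 2 * M a b.
Proof. by []. Qed.

Lemma is_pseudometric_KAC_dist : is_pseudometric (@KAC_dist R e Z).
Proof.
split=> [a|a b|a b c].
- by rewrite KAC_distE segment_minxx; lra.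
- by rewrite !KAC_distE segment_minC; lra.
- have := segment_min_ultra a c b; have := segment_min_ler a b.
  have := segment_min_lel b c.
  rewrite !KAC_distE.
  move: (M a b) (M b c) (M a c) (label Z a) (label Z b) (label Z c).
  by move=> ? ? ? ? ? ? ? ? [?|?]; lra.
Qed.

(** * Continuity of the projection from the tree to the map *)

Lemma tree_dist_near (t : time R) (eps : R) : 0 < eps ->
  exists2 delta, 0 < delta & forall s : time R, `|val t - val s| < delta ->
    pdist (pe t) (pe s) < eps /\ D (Pi (pe t)) (Pi (pe s)) < eps.
Proof.
move=> eps0.
have [de de0 dP] := path_min_near e ce _ _ (time01 t) eps0.
have [dz dz0 zP] := path_min_near Z cZ _ _ (time01 t) eps0.
exists (Num.min de dz) => [|s]; first by rewrite lt_min de0.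
rewrite lt_min => /andP[ts tsz]; split.
  by rewrite pdist_tree//; exact: dP (time01 s) ts.
apply: le_lt_trans (zP _ (time01 s) tsz).
have [_ D2 _] := DP; have [_ _ DC _] := mD.
(* Property 2 bounds [D] by the analogue of [tree_dist] for $Z$ when its first time is the smaller
   one. Otherwise the cyclic interval wraps around, and the arguments are first exchanged by
   symmetry of [D]. *)
have [ts'|ts'] := leP (val t) (val s).
  by apply: le_trans (D2 _ _) _; rewrite /cyclic_interval /path_min minEle maxEle ts'.
rewrite -[X in X <= _]DC/=; apply: le_trans (D2 _ _) _.
by rewrite (path_minC Z (val t)) [Z _ + _]addrC /cyclic_interval /path_min
  minEle maxEle (ltW ts').
Qed.

(* Otherwise times [s] with [pe s] close to [a] but [Pi (pe s)] far from [Pi a]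
   accumulate at some [t], and [pe t = a] contradicts [tree_dist_near]. *)
Lemma m_proj_continuous a (eps : R) : 0 < eps ->
  exists2 delta, 0 < delta & forall b, pdist a b < delta -> D (Pi a) (Pi b) < eps.
Proof.
move=> eps0; apply: contrapT => noD.
have [d0 deq dC dtri] := mT.
pose bad (delta : R) := [set val s | s in
  [set s | pdist a (pe s) < delta /\ eps <= D (Pi a) (Pi (pe s))]].
(* The sets of bad times generate a proper filter, to which compactness of $[0,1]$ applies. *)
have bad_filter : ProperFilter (filter_from [set delta : R | 0 < delta] bad).
  apply: filter_from_proper => [|delta /= delta0].
    apply: filter_from_filter; first by exists 1 => /=.
    move=> i j /= i0 j0; exists (Num.min i j) => /=; first by rewrite lt_min i0.
    by move=> _ [s [+ Ds] <-]; rewrite lt_min => /andP[si sj]; split; exists s.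
  apply: contrapT => /set0P/negP/negPn/eqP b0; apply: noD.
  exists delta => // b ab; rewrite ltNge; apply/negP => Db.
  have [s sb] := tree_projP e b.
  have : bad delta (val s) by exists s => //; split; rewrite /= sb.
  by rewrite b0.
have [|x [/=]] := @segment_compact R 0 1 _ bad_filter.
  by exists 1 => //= _ [s _ <-] /=; rewrite in_itv/=; exact: time01.
rewrite in_itv/= => /time_of[t <-] clt.
have near_t (eta : R) : 0 < eta -> exists s, [/\ pdist a (pe s) < eta,
    eps <= D (Pi a) (Pi (pe s)), pdist (pe t) (pe s) < eta
    & D (Pi (pe t)) (Pi (pe s)) < eps].
  move=> eta0.
  have [delta delta0 dP] := tree_dist_near t (Num.min eta eps) ltac:(by rewrite lt_min eta0).
  have [_ [[s [as_ Ds] <-] ts]] : (bad eta `&` ball (val t) delta) !=set0.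
    by apply: clt; [exists eta|exact: nbhsx_ballx].
  by exists s; have [+ +] := dP s ts; rewrite !lt_min => /andP[? _] /andP[_ ?].
have at_ : a = pe t.
  apply/deq/eqP; rewrite eq_le d0 andbT leNgt; apply/negP => at0.
  have [|s [as_ _ ts _]] := near_t (pdist a (pe t) / 2); first by lra.
  move: as_ ts (dtri a (pe s) (pe t)); rewrite (dC (pe s)).
  by move: (pdist a (pe t)) (pdist a (pe s)) (pdist (pe t) (pe s)) => ? ? ?; lra.
by have [s []] := near_t 1 ltr01; rewrite at_; lra.
Qed.

(** * Comparison of the two cactus distances *)

Lemma pdist_base a : pdist (pbase (m_space D)) (Pi a) = label Z a - label_min Z.
Proof. exact: D_base. Qed.

(** Property 3 of [D], solved for the minimum over the segment. *)
Lemma segment_min_ge_dist a b : label Z a + label Z b - D (Pi a) (Pi b) <= 2 * M a b.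
Proof.
have [_ _ D3] := DP; have := D3 a b; rewrite KAC_distE.
by move: (label Z a) (label Z b) (M a b) (D _ _) => ? ? ? ?; lra.
Qed.

(** The curve is the image of the tree geodesic, reparametrized to $[0,1]$. *)
Lemma curve_along_segment a b : exists2 g, @curve R (m_space D) (Pi a) (Pi b) g &
  forall t : R, 0 <= t <= 1 -> M a b - label_min Z <= pdist (pbase (m_space D)) (g t).
Proof.
have [d0 deq dC dtri] := mT.
have [g gP] := four_point_geodesic _ mT T4 Tdiv a b.
have [g0 g1 gd] := gP; pose l := pdist a b.
have l0 : 0 <= l by exact: d0.
have tl (t : R) : 0 <= t <= 1 -> t * l \in `[0, l].
  by rewrite in_itv/= => /andP[t0 t1]; rewrite mulr_ge0//= ler_piMl.
exists (fun t => Pi (g (t * l))); last first.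
  move=> t t01; rewrite pdist_base lerD2r; apply: segment_min_le.
  by exists g => //; exists (t * l) => //; exact: tl.
split; [|by rewrite mul0r g0|by rewrite mul1r g1].
apply/(pspace_within01_continuousP _ _ mD) => x x01 eps eps0.
have [delta delta0 dP] := m_proj_continuous (g (x * l)) eps eps0.
(* Dividing by $l+1$ rather than $l$ covers the case $a=b$, where $l=0$. *)
exists (delta / (l + 1)) => [|y y01 xy]; first by rewrite divr_gt0//; lra.
apply: dP; rewrite gd ?tl// -mulrBl normrM (ger0_norm l0).
move: xy; rewrite ltr_pdivlMr; last by lra.
by apply: le_lt_trans; rewrite ler_wpM2l//; lra.
Qed.

(* Cutting the curve into small steps, [segment_min_ge_dist] bounds [M] along each
   step, and the ultrametric inequality for [M] concatenates the steps. *)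
Lemma curve_min_le_segment_min a b g (h : R) : @curve R (m_space D) (Pi a) (Pi b) g ->
  (forall t : R, 0 <= t <= 1 -> h <= pdist (pbase (m_space D)) (g t)) ->
  h <= M a b - label_min Z.
Proof.
move=> [cg g0 g1] hg; have [d0 deq dC dtri] := mD.
have lab c (t : R) : 0 <= t <= 1 -> Pi c = g t -> h + label_min Z <= label Z c.
  move=> /hg + ct; rewrite -ct pdist_base.
  by move: (label Z c) (label_min Z) => ? ?; lra.
apply/ler_addgt0Pr => eps eps0.
suff : h + label_min Z - eps <= M a b.
  by move: (label_min Z) (M a b) => ? ?; lra.
have z01 : 0 <= (0 : R) <= 1 by rewrite lexx ler01.
(* All representatives [c] of [g t] are included. Each step joins [M a c'] and [M c' c] by a
   minimum, so [eps] is lost once and does not accumulate. *)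
pose P (t : R) := forall c, Pi c = g t -> h + label_min Z - eps <= M a c.
apply: (unit_interval_induction P); last by rewrite g1.
  (* Here [c] may differ from [a] in the tree, but their images coincide and are at distance $0$. *)
  move=> c c0; have := segment_min_ge_dist a c; rewrite c0 g0.
  rewrite (_ : D _ _ = 0); last exact/(deq (Pi a)).
  have := lab c 0 z01 c0; have := lab a 0 z01 (esym g0).
  by move: (label Z a) (label Z c) (M a c) (label_min Z) => ? ? ? ?; lra.
move=> x x01.
have [delta delta0 dg] := (pspace_within01_continuousP _ _ mD).1 cg x x01 eps eps0.
exists delta => // u v u01 v01 xu xv Pu c cv.
have [c' cu] := m_projP (g u).
have := segment_min_ge_dist c' c; rewrite cu cv.
have := dtri (g u) (g x) (g v); rewrite (dC (g u) (g x)) /=.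
have := dg u u01 xu; have := dg v v01 xv; rewrite /=.
have := lab c v v01 cv; have := lab c' u u01 cu.
have := Pu c' cu; have := segment_min_ultra a c c'.
move: (M a c) (M a c') (M c' c) (label Z c) (label Z c') (label_min Z).
move: (D _ _) (D _ _) (D _ _) => ? ? ? ? ? ? ? ? ? [?|?]; lra.
Qed.

(** The terms [label_min] cancel once the supremum over curves is $\min_{[[a,b]]}Z-\underline Z$:
    every curve stays below this value, and the image of the segment reaches it. *)
Lemma kac_dist_m_proj a b : @kac_dist R (m_space D) (Pi a) (Pi b) = KAC_dist Z a b.
Proof.
rewrite /kac_dist !pdist_base KAC_distE.
set S := [set _ | _ in _].
have SP x : S x -> x <= M a b - label_min Z.
  move=> [g cg <-]; apply: curve_min_le_segment_min cg _ => t t01.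
  apply: ge_inf; last by exists t => //=; rewrite in_itv.
  by exists 0 => _ [u _ <-]; case: mD.
have [g cg gM] := curve_along_segment a b.
have Sg : S (inf [set pdist (pbase (m_space D)) (g t) | t in `[0, 1]%classic]) by exists g.
suff -> : sup S = M a b - label_min Z.
  by move: (label Z a) (label Z b) (M a b) (label_min Z) => ? ? ? ?; lra.
apply/eqP; rewrite eq_le; apply/andP; split.
  by apply: ge_sup; [exists (inf [set pdist (pbase (m_space D)) (g t) | t in `[0, 1]%classic])|].
apply: le_trans (ub_le_sup _ Sg); last by exists (M a b - label_min Z).
apply: lb_le_inf; last by move=> _ [t /= + <-]; rewrite in_itv; exact: gM.
by exists (pdist (pbase (m_space D)) (g 0)), 0 => //=; rewrite in_itv/= lexx ler01.
Qed.

Lemma isometric_Kac_KAC : isometric (Kac (m_space D)) (KAC e Z).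
Proof.
apply: (isometric_metric_quotient _ _ Pi _ is_pseudometric_KAC_dist).
  exact: m_projP.
exact: kac_dist_m_proj.
Qed.

End Cactus.

(** * Passage to the almost sure event where [e] and [Z] are continuous and [D] has its
    properties *)

Theorem proposition3p2 (R : realType) (d : measure_display)
    (Om : measurableType d) (P : probability Om R)
    (e Z : process P)
    (p : nat) (sub : nat -> nat)
    (D : forall w : Om, m_infty (traj e w) (traj Z w) ->
                        m_infty (traj e w) (traj Z w) -> R)
    (he : brownian_excursion e)
    (hZ : brownian_labels e Z)
    (hp : (2 <= p)%N)
    (hsub : {homo sub : i j / (i < j)%N})
    (hD : brownian_map p sub D) :
  {ae P, forall w, isometric (Kac (m_space (D w))) (KAC (traj e w) (traj Z w))}.
Proof.
have [ce _ _] := he; have [cZ _] := hZ; have [_ _ hmetric hspec] := hD.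
apply: filterS3 ce cZ (filterI hmetric hspec) => w cew cZw [[[mw _] _] sw].
exact: isometric_Kac_KAC.
Qed.
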